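(* Let $A\in\mathbb{R}^{m\times n}$, $g(z)=(A^\top z^{\mathsf y},-Az^{\mathsf x})$, $w_0\in\mathcal{Z}$ and $\tau>0$. In the $\ell_2$-$\ell_1$ setup, the clipped estimator $$\tilde g_{w_0}(w)=\left(A^\top w_0^{\mathsf y}+A_{i:}\frac{[w^{\mathsf y}]_i-[w_0^{\mathsf y}]_i}{p_i(w)},\ -Aw_0^{\mathsf x}-\mathsf T_\tau\left(A_{:j}\frac{[w^{\mathsf x}]_j-[w_0^{\mathsf x}]_j}{q_j(w)}\right)\right),$$ where $i\sim p(w)$ and $j\sim q(w)$ are drawn independently with $$p_i(w)=\frac{|[w^{\mathsf y}]_i-[w_0^{\mathsf y}]_i|}{\|w^{\mathsf y}-w_0^{\mathsf y}\|_1},\qquad q_j(w)=\frac{([w^{\mathsf x}]_j-[w_0^{\mathsf x}]_j)^2}{\|w^{\mathsf x}-w_0^{\mathsf x}\|_2^2},$$ and $[\mathsf T_\tau(v)]_k=\min\{\tau,\max\{-\tau,[v]_k\}\}$, is $(w_0,L,\tau)$-CBB for $g$ with $L=\|A\|_{2\to\infty}=\max_{i\in[m]}\|A_{i:}\|_2$.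
   Context: $\ell_2$-$\ell_1$ setup: $\mathcal{X}=\{x\in\mathbb{R}^n:\|x\|_2\le1\}$, $\mathcal{Y}=\{y\in\mathbb{R}^m:y\ge0,\|y\|_1=1\}$, $\mathcal{Z}=\mathcal{X}\times\mathcal{Y}$; $z^{\mathsf x},z^{\mathsf y}$ are the first $n$ and last $m$ coordinates of $z$; norm $\|z\|^2=\|z^{\mathsf x}\|_2^2+\|z^{\mathsf y}\|_1^2$, dual norm $\|\gamma\|_*^2=\|\gamma^{\mathsf x}\|_2^2+\|\gamma^{\mathsf y}\|_\infty^2$. $A_{i:},A_{:j}$ are the $i$th row and $j$th column of $A$ as vectors. If $w^{\mathsf y}=w_0^{\mathsf y}$ (resp. $w^{\mathsf x}=w_0^{\mathsf x}$) the corresponding increment is $0$. A stochastic estimator $\tilde g_{w_0}:\mathcal{Z}\to\mathcal{Z}^*$ is $(w_0,L,\tau)$-centered-bounded-biased (CBB) for $g$ if for all $w\in\mathcal{Z}$: (1) $\mathbb{E}\tilde g^{\mathsf x}_{w_0}(w)=g^{\mathsf x}(w)$ and $\|\mathbb{E}\tilde g^{\mathsf y}_{w_0}(w)-g^{\mathsf y}(w)\|_\infty\le\frac{L^2}{\tau}\|w-w_0\|^2$; (2) $\|\tilde g^{\mathsf y}_{w_0}(w)-g^{\mathsf y}(w_0)\|_\infty\le\tau$; (3) $\mathbb{E}\|\tilde g^{\mathsf x}_{w_0}(w)-g^{\mathsf x}(w_0)\|_2^2+\max_{i\in[m]}\mathbb{E}[\tilde g^{\mathsf y}_{w_0}(w)-g^{\mathsf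 y}(w_0)]_i^2\le L^2\|w-w_0\|^2$. *)

(* Defs.v *)
(* MathComp world, with MathComp-Analysis. *)
From HB Require Import structures.
From mathcomp Require Import all_boot all_order all_algebra.
From mathcomp Require Import all_classical all_reals all_analysis.
Set Implicit Arguments.
Unset Strict Implicit.
Unset Printing Implicit Defensive.
Import Order.TTheory GRing.Theory Num.Theory.
Import numFieldNormedType.Exports.
Local Open Scope classical_set_scope.
Local Open Scope ring_scope.

Definition l2norm (R : realType) (n : nat) (v : 'cV[R]_n) : R :=
  Num.sqrt (\sum_(i < n) v i 0 ^+ 2).

Definition l1norm (R : realType) (n : nat) (v : 'cV[R]_n) : R :=
  \sum_(i < n) `|v i 0|.

(* The library norm on matrices is the largest absolute value of an entry. *)
Definition linfnorm (R : realType) (n : nat) (v : 'cV[R]_n) : R := `|v|.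

(* The pair z = (z.1, z.2) stands for (z^x, z^y).  Points of Z and of its dual
   Z^* are both represented in this type. *)
Definition vpair (R : realType) (n m : nat) : Type :=
  ('cV[R]_n * 'cV[R]_m)%type.

Definition ballX (R : realType) (n : nat) : set 'cV[R]_n :=
  [set x : 'cV[R]_n | l2norm x <= 1].

Definition simplexY (R : realType) (m : nat) : set 'cV[R]_m :=
  [set y : 'cV[R]_m | (forall i, 0 <= y i 0) /\ l1norm y = 1].

Definition domZ (R : realType) (n m : nat) : set (vpair R n m) :=
  [set z : vpair R n m | ballX z.1 /\ simplexY z.2].

(* The squared distance ||w - w0||^2 for ||z||^2 = ||z^x||_2^2 + ||z^y||_1^2. *)
Definition sqdist (R : realType) (n m : nat) (w w0 : vpair R n m) : R :=
  l2norm (w.1 - w0.1) ^+ 2 + l1norm (w.2 - w0.2) ^+ 2.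

Definition integrable_vector (d : measure_display) (T : measurableType d)
    (R : realType) (P : probability T R) (n : nat) (X : T -> 'cV[R]_n) : Prop :=
  forall i, P.-integrable [set: T] (fun t => (X t i 0)%:E).

Definition mean (d : measure_display) (T : measurableType d) (R : realType)
    (P : probability T R) (n : nat) (X : T -> 'cV[R]_n) : 'cV[R]_n :=
  \col_i fine 'E_P[fun t => X t i 0].

(* A stochastic estimator is a family of integrable random vectors, so that
   its componentwise mean is genuine. *)
Definition stochastic_estimator (d : measure_display) (T : measurableType d)
    (R : realType) (P : probability T R) (n m : nat)
    (gt : vpair R n m -> T -> vpair R n m) : Prop :=
  forall w, domZ w ->
    integrable_vector P (fun t => (gt w t).1) /\
    integrable_vector P (fun t => (gt w t).2).

(* The second moments are extended-real valued.  The base value 0 of the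
   maximum is harmless: these moments are nonnegative and the index set [m] is
   nonempty as soon as Z is. *)
Definition CBB (d : measure_display) (T : measurableType d) (R : realType)
    (P : probability T R) (n m : nat) (w0 : vpair R n m) (L tau : R)
    (g : vpair R n m -> vpair R n m)
    (gt : vpair R n m -> T -> vpair R n m) : Prop :=
  stochastic_estimator P gt /\
  forall w, domZ w ->
    [/\ mean P (fun t => (gt w t).1) = (g w).1 /\
        linfnorm (mean P (fun t => (gt w t).2) - (g w).2)
          <= L ^+ 2 / tau * sqdist w w0,
        forall t, linfnorm ((gt w t).2 - (g w0).2) <= tau
      & ('E_P[fun t => (l2norm ((gt w t).1 - (g w0).1) ^+ 2)%R]
         + \big[maxe/0]_(i < m)
             'E_P[fun t => (((gt w t).2 - (g w0).2)%R i 0%R ^+ 2)%R]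
         <= (L ^+ 2 * sqdist w w0)%:E)%E].

Definition bilinear_grad (R : realType) (n m : nat) (A : 'M[R]_(m, n))
    (z : vpair R n m) : vpair R n m :=
  (A^T *m z.2, - (A *m z.1)).

Definition norm_2_inf (R : realType) (n m : nat) (A : 'M[R]_(m, n)) : R :=
  \big[Num.max/0]_(i < m) l2norm (row i A)^T.

Definition clip (R : realType) (n : nat) (tau : R) (v : 'cV[R]_n) : 'cV[R]_n :=
  \col_k Num.min tau (Num.max (- tau) (v k 0)).

Definition p_prob (R : realType) (n m : nat) (w0 w : vpair R n m) (i : 'I_m) : R :=
  `|w.2 i 0 - w0.2 i 0| / l1norm (w.2 - w0.2).

Definition q_prob (R : realType) (n m : nat) (w0 w : vpair R n m) (j : 'I_n) : R :=
  (w.1 j 0 - w0.1 j 0) ^+ 2 / l2norm (w.1 - w0.1) ^+ 2.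

(* The value of the estimator for the drawn indices i, j.  If w.2 = w0.2 (resp.
   w.1 = w0.1) the numerator vanishes, hence so does the increment, whatever
   the index; recall that x / 0 = 0. *)
Definition clipped_value (R : realType) (n m : nat) (A : 'M[R]_(m, n))
    (tau : R) (w0 w : vpair R n m) (i : 'I_m) (j : 'I_n) : vpair R n m :=
  (A^T *m w0.2 + ((w.2 i 0 - w0.2 i 0) / p_prob w0 w i) *: (row i A)^T,
   - (A *m w0.1)
   - clip tau (((w.1 j 0 - w0.1 j 0) / q_prob w0 w j) *: col j A)).

Definition has_law (d : measure_display) (T : measurableType d) (R : realType)
    (P : probability T R) (K : finType) (X : T -> K) (p : K -> R) : Prop :=
  forall k, P (X @^-1` [set k]) = (p k)%:E.

(* I w and J w are the random indices i and j drawn at the point w.  The laws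
   p(w), q(w) are 0/0, and the index is then unconstrained, when w.2 = w0.2
   (resp. w.1 = w0.1). *)
Definition index_sampling (d : measure_display) (T : measurableType d)
    (R : realType) (P : probability T R) (n m : nat) (w0 : vpair R n m)
    (I : vpair R n m -> T -> 'I_m) (J : vpair R n m -> T -> 'I_n) : Prop :=
  forall w, domZ w ->
    [/\ (forall i, measurable (I w @^-1` [set i])) /\
        (forall j, measurable (J w @^-1` [set j])),
        w.2 <> w0.2 -> has_law P (I w) (p_prob w0 w),
        w.1 <> w0.1 -> has_law P (J w) (q_prob w0 w)
      & forall i j, P (I w @^-1` [set i] `&` J w @^-1` [set j]) =
                    (P (I w @^-1` [set i]) * P (J w @^-1` [set j]))%E].

(* Main.v *)
Require Import Defs.
From HB Require Import structures.
From mathcomp Require Import all_boot all_order all_algebra.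
From mathcomp Require Import all_classical all_reals all_analysis.
From mathcomp Require Import ring lra.
Set Implicit Arguments.
Unset Strict Implicit.
Unset Printing Implicit Defensive.
Import Order.TTheory GRing.Theory Num.Theory.
Import numFieldNormedType.Exports.
Local Open Scope classical_set_scope.
Local Open Scope ring_scope.

(* Sampling an index with probability r_k and returning u_k / r_k is unbiased
   for the sum of the u_k, with second moment the sum of the u_k^2 / r_k.  In the
   x-block r_k is proportional to |u_k|, so u_k^2 / r_k = |u_k| ||u||_1; in the
   y-block r_k is proportional to u_k^2, so u_k^2 / r_k = ||u||_2^2 whenever
   u_k <> 0, and summing against A_{ik}^2 gives ||u||_2^2 ||A_{i:}||_2^2.
   Clipping does not increase the second moment, and moves a real x by at most
   x^2 / tau, so the bias is controlled by the second moment. *)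

Section FiniteIndex.
Context (d : measure_display) (T : measurableType d) (R : realType).
Context (P : probability T R) (K : finType) (X : T -> K).

(** The actual law of [X]. Weighting by it keeps the sums meaningful when the prescribed law
    degenerates to 0/0. *)
Definition index_law (k : K) : R := fine (P (X @^-1` [set k])).

Lemma index_law_ge0 k : 0 <= index_law k.
Proof. by rewrite fine_ge0. Qed.

Lemma has_law_index_law (p : K -> R) : has_law P X p -> index_law =1 p.
Proof. by move=> Xp k; rewrite /index_law Xp. Qed.

Hypothesis mX : forall k, measurable (X @^-1` [set k]).

(** Exactly one fibre of [X] contains [t], so [f (X t)] is a finite combination of indicators;
    integrability and expectation follow by linearity. *)
Let comp_sum_indic (f : K -> R) :
  (fun t => (f (X t))%:E) =
  (fun t => \sum_k (f k)%:E * (\1_(X @^-1` [set k]) t)%:E)%E.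
Proof.
apply/funext => t; rewrite (bigD1 (X t)) //= big1 ?adde0 => [|k kX].
  by rewrite indicE mem_set // mule1.
by rewrite indicE memNset ?mule0 // => /= Xk; rewrite Xk eqxx in kX.
Qed.

Lemma integrable_finite_index (f : K -> R) :
  P.-integrable [set: T] (fun t => (f (X t))%:E).
Proof.
rewrite comp_sum_indic; apply: integrable_sum => // k _.
by apply: integrableZl => //; apply: integrable_indic.
Qed.

Lemma expectation_finite_index (f : K -> R) :
  ('E_P[fun t => f (X t)] = (\sum_k index_law k * f k)%R%:E)%E.
Proof.
rewrite unlock comp_sum_indic integral_sum //; last first.
  by move=> k; apply: integrableZl => //; apply: integrable_indic.
rewrite -sumEFin; apply: eq_bigr => k _.
rewrite integralZl //; last exact: integrable_indic.
by rewrite integral_indic // setIT mulrC EFinM fineK // fin_num_measure.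
Qed.

Lemma sum_index_law : \sum_k index_law k = 1.
Proof.
apply: EFin_inj; have := expectation_finite_index (cst 1).
rewrite [X in X = _]expectation_cst => ->.
by congr EFin; apply: eq_bigr => k _; rewrite mulr1.
Qed.

End FiniteIndex.

Section Norms.
Context (R : realType).
Implicit Types n m : nat.

Lemma l2norm_ge0 n (v : 'cV[R]_n) : 0 <= l2norm v.
Proof. exact: sqrtr_ge0. Qed.

Lemma l2norm_sq n (v : 'cV[R]_n) : l2norm v ^+ 2 = \sum_(i < n) v i 0 ^+ 2.
Proof. by rewrite sqr_sqrtr // sumr_ge0 // => i _; rewrite sqr_ge0. Qed.

Lemma l1norm_ge0 n (v : 'cV[R]_n) : 0 <= l1norm v.
Proof. exact: sumr_ge0. Qed.

Lemma l2norm_neq0 n (v : 'cV[R]_n) i : v i 0 != 0 -> l2norm v != 0.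
Proof.
apply: contraNneq => v0; have := l2norm_sq v.
rewrite v0 expr0n => /esym/eqP; rewrite psumr_eq0 => [/allP/(_ i)|j _].
  by rewrite mem_index_enum sqrf_eq0 => /(_ isT).
exact: sqr_ge0.
Qed.

Lemma l1norm_neq0 n (v : 'cV[R]_n) i : v i 0 != 0 -> l1norm v != 0.
Proof.
apply: contraNneq => /eqP; rewrite psumr_eq0 => [/allP/(_ i)|//].
by rewrite mem_index_enum normr_eq0 => /(_ isT).
Qed.

Lemma linfnorm_le n (v : 'cV[R]_n) (M : R) :
  0 <= M -> (forall i, `|v i 0| <= M) -> linfnorm v <= M.
Proof.
move=> M0 vM; rewrite /linfnorm /Num.Def.normr /= mx_normrE.
by apply: bigmax_le => // -[i j] _ /=; rewrite ord1.
Qed.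

Lemma row_sq_le_norm_2_inf n m (A : 'M[R]_(m, n)) i :
  \sum_(j < n) A i j ^+ 2 <= norm_2_inf A ^+ 2.
Proof.
have -> : \sum_(j < n) A i j ^+ 2 = l2norm (row i A)^T ^+ 2.
  by rewrite l2norm_sq; apply: eq_bigr => j _; rewrite !mxE.
have Ai : l2norm (row i A)^T <= norm_2_inf A.
  exact: (le_bigmax _ (fun i => l2norm (row i A)^T)).
by rewrite ler_pXn2r // nnegrE ?l2norm_ge0 // (le_trans _ Ai) ?l2norm_ge0.
Qed.

End Norms.

Section Clipping.
Context (R : realType) (tau : R).
Hypothesis tau_gt0 : 0 < tau.
Let clip1 (x : R) : R := Num.min tau (Num.max (- tau) x).

Lemma clip_abs_le x : `|clip1 x| <= tau.
Proof.
by rewrite ler_norml /clip1 le_min ge_min le_max !lexx /=; have := tau_gt0; lra.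
Qed.

Lemma clip_sq_le x : clip1 x ^+ 2 <= x ^+ 2.
Proof.
rewrite /clip1; have t0 := tau_gt0.
case: (leP (- tau) x) => x1;
  [case: (leP tau x) => x2 | case: (leP tau (- tau)) => x2]; nra.
Qed.

(** The difference vanishes for |x| <= tau. Otherwise it is |x| - tau, and |x| <= x^2 / tau because
    |x| > tau. *)
Lemma clip_bias_le x : `|x - clip1 x| <= x ^+ 2 / tau.
Proof.
rewrite ler_pdivlMr // /clip1; have t0 := tau_gt0.
case: (leP (- tau) x) => x1;
  [case: (leP tau x) => x2 | case: (leP tau (- tau)) => x2].
- by rewrite ger0_norm; nra.
- by rewrite subrr normr0 mul0r sqr_ge0.
(* Here tau <= - tau, which contradicts tau > 0. *)
- lra.
- by rewrite ler0_norm; nra.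
Qed.

End Clipping.

(* The law [r] is unconstrained where [u] vanishes: this covers the case of a
   zero increment, in which the sampling law is arbitrary. *)
Section ImportanceSampling.
Context (R : realType) (K : finType) (r p u : K -> R).
Hypothesis rp : forall k, u k != 0 -> r k = p k /\ p k != 0.

Lemma importance_mean k : r k * (u k / p k) = u k.
Proof.
have [->|uk] := eqVneq (u k) 0; first by rewrite mul0r mulr0.
by have [-> pk] := rp uk; field.
Qed.

Lemma importance_sq k : r k * (u k / p k) ^+ 2 = u k ^+ 2 / p k.
Proof. by rewrite expr2 mulrA importance_mean mulrA -expr2. Qed.

End ImportanceSampling.

Theorem lemma4 (R : realType) (n m : nat) (A : 'M[R]_(m, n))
    (w0 : vpair R n m) (tau : R)
    (d : measure_display) (T : measurableType d) (P : probability T R)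
    (I : vpair R n m -> T -> 'I_m) (J : vpair R n m -> T -> 'I_n) :
  domZ w0 -> 0 < tau ->
  index_sampling P w0 I J ->
  CBB P w0 (norm_2_inf A) tau (bilinear_grad A)
    (fun w t => clipped_value A tau w0 w (I w t) (J w t)).
Proof.
move=> _ tau0 samp.
have value1 w i j k : (clipped_value A tau w0 w i j).1 k 0 =
    (A^T *m w0.2) k 0 + (w.2 i 0 - w0.2 i 0) / p_prob w0 w i * A i k.
  by rewrite !mxE.
have value2 w i j k : (clipped_value A tau w0 w i j).2 k 0 =
    - (A *m w0.1) k 0 - Num.min tau (Num.max (- tau)
      ((w.1 j 0 - w0.1 j 0) / q_prob w0 w j * A k j)).
  by rewrite !mxE.
(* The deterministic part of each block is the value of g at [w0], so centering there leaves only
   the sampled increment. *)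
have centered1 w i j k :
    ((clipped_value A tau w0 w i j).1 - (bilinear_grad A w0).1) k 0 =
    (w.2 i 0 - w0.2 i 0) / p_prob w0 w i * A i k.
  by rewrite !mxE addrAC subrr add0r.
have centered2 w i j k :
    ((clipped_value A tau w0 w i j).2 - (bilinear_grad A w0).2) k 0 =
    - Num.min tau (Num.max (- tau)
      ((w.1 j 0 - w0.1 j 0) / q_prob w0 w j * A k j)).
  by rewrite !mxE addrAC subrr add0r.
split.
  move=> w /samp[[mI mJ] _ _ _]; split => k.
    under eq_fun do rewrite value1.
    exact: (integrable_finite_index _ mI (fun i => (A^T *m w0.2) k 0 +
      (w.2 i 0 - w0.2 i 0) / p_prob w0 w i * A i k)).
  under eq_fun do rewrite value2.
  exact: (integrable_finite_index _ mJ (fun j => - (A *m w0.1) k 0 -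
    Num.min tau (Num.max (- tau)
      ((w.1 j 0 - w0.1 j 0) / q_prob w0 w j * A k j)))).
move=> w /samp[[mI mJ] lawI lawJ _].
pose u i : R := w.2 i 0 - w0.2 i 0.
pose v j : R := w.1 j 0 - w0.1 j 0.
pose b i := u i / p_prob w0 w i.
pose c j := v j / q_prob w0 w j.
pose clipc k j := Num.min tau (Num.max (- tau) (c j * A k j)).
set L := norm_2_inf A.
set r := index_law P (I w); set s := index_law P (J w).
have uE i : (w.2 - w0.2) i 0 = u i by rewrite !mxE.
have vE j : (w.1 - w0.1) j 0 = v j by rewrite !mxE.
(* A nonzero coordinate forces [w.2 <> w0.2], which is where the sampling law is prescribed. *)
have rp i : u i != 0 -> r i = p_prob w0 w i /\ p_prob w0 w i != 0.
  move=> ui; split.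
    apply: has_law_index_law; apply: lawI => ww.
    by rewrite /u ww subrr eqxx in ui.
  by rewrite mulf_neq0 ?normr_eq0 ?invr_eq0 // (@l1norm_neq0 _ _ _ i) ?uE.
have sq j : v j != 0 -> s j = q_prob w0 w j /\ q_prob w0 w j != 0.
  move=> vj; split.
    apply: has_law_index_law; apply: lawJ => ww.
    by rewrite /v ww subrr eqxx in vj.
  rewrite mulf_neq0 ?invr_eq0 ?expf_neq0 //.
  by rewrite (@l2norm_neq0 _ _ _ j) ?vE.
have s_ge0 j : 0 <= s j by apply: index_law_ge0.
have r_b2 i : r i * b i ^+ 2 = `|u i| * l1norm (w.2 - w0.2).
  rewrite (importance_sq rp) /p_prob -/(u i).
  have [->|ui] := eqVneq (u i) 0; first by rewrite normr0 expr0n !mul0r.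
  by rewrite -real_normK ?num_real // invf_div; field; rewrite normr_eq0.
(* Equality can fail when [v j = 0]: the left side is then 0, while the norm may be positive. *)
have s_c2 j : s j * c j ^+ 2 <= l2norm (w.1 - w0.1) ^+ 2.
  rewrite (importance_sq sq) /q_prob -/(v j).
  have [->|vj] := eqVneq (v j) 0; first by rewrite expr0n !mul0r sqr_ge0.
  by rewrite invf_div mulrC divfK ?sqrf_eq0.
(* The |u_i| sum to the l1 norm of the y-increment, and every row has squared norm at most L^2. *)
have momentX : \sum_i r i * (b i ^+ 2 * \sum_k A i k ^+ 2)
    <= L ^+ 2 * l1norm (w.2 - w0.2) ^+ 2.
  have -> : L ^+ 2 * l1norm (w.2 - w0.2) ^+ 2 =
      \sum_i `|u i| * l1norm (w.2 - w0.2) * L ^+ 2.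
    rewrite -!mulr_suml expr2 mulrA mulrC mulrA -mulrA [X in _ * X]mulrC mulrA.
    by do 2 congr (_ * _); apply: eq_bigr => i _; rewrite uE.
  apply: ler_sum => i _; rewrite mulrA r_b2.
  by rewrite ler_wpM2l ?row_sq_le_norm_2_inf // mulr_ge0 ?l1norm_ge0.
(* Being uniform in the row [k], this bound serves both the bias and the maximum of the second
   moments. *)
have momentY k :
    \sum_j s j * (c j * A k j) ^+ 2 <= L ^+ 2 * l2norm (w.1 - w0.1) ^+ 2.
  rewrite [leRHS]mulrC; apply: (@le_trans _ _
    (l2norm (w.1 - w0.1) ^+ 2 * \sum_j A k j ^+ 2)).
    rewrite mulr_sumr; apply: ler_sum => j _.
    by rewrite exprMn mulrA ler_wpM2r ?sqr_ge0.
  by rewrite ler_wpM2l ?sqr_ge0 // row_sq_le_norm_2_inf.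
split; [split | |].
- apply/colP => k; rewrite mxE; under eq_fun do rewrite value1.
  rewrite (expectation_finite_index P mI (fun i => (A^T *m w0.2) k 0 +
      b i * A i k)) /=.
  under eq_bigr do rewrite mulrDr mulrA (importance_mean rp).
  rewrite big_split /= -mulr_suml (sum_index_law P mI) mul1r !mxE -big_split /=.
  by apply: eq_bigr => i _; rewrite !mxE /u; ring.
- apply: linfnorm_le => [|k].
    by rewrite mulr_ge0 ?divr_ge0 ?addr_ge0 ?sqr_ge0 // ltW.
  rewrite !mxE; under eq_fun do rewrite value2.
  rewrite (expectation_finite_index P mJ (fun j => - (A *m w0.1) k 0 -
      clipc k j)) /=.
  under eq_bigr do rewrite mulrBr.
  rewrite sumrB -mulr_suml (sum_index_law P mJ) mul1r.
  (* Without clipping the estimator is unbiased, so the bias is the mean clipping error, bounded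
     termwise by x^2 / tau. *)
  rewrite (_ : _ - _ = \sum_j s j * (c j * A k j - clipc k j)); last first.
    under [RHS]eq_bigr do rewrite mulrBr mulrA (importance_mean sq).
    rewrite sumrB opprK addrAC; congr (_ - _).
    rewrite mxE addrC -sumrB; apply: eq_bigr => j _; rewrite /v; ring.
  apply: (le_trans (ler_norm_sum _ _ _)).
  apply: (@le_trans _ _ ((\sum_j s j * (c j * A k j) ^+ 2) / tau)).
    rewrite mulr_suml; apply: ler_sum => j _.
    by rewrite normrM ger0_norm // -mulrA ler_wpM2l // clip_bias_le.
  rewrite mulrAC ler_wpM2r ?invr_ge0 ?(ltW tau0) //.
  apply: le_trans (momentY k) _.
  by rewrite ler_wpM2l ?sqr_ge0 // lerDl sqr_ge0.
- move=> t; apply: linfnorm_le => [|k]; first exact: ltW.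
  by rewrite centered2 normrN clip_abs_le.
(* The blocks cross: the y-moment is bounded by the x-increment and the x-moment by the y-increment,
   hence the swap before comparing termwise. *)
- rewrite /sqdist mulrDr addrC EFinD; apply: leeD.
    apply: bigmax_le => [|k _].
      by rewrite lee_fin mulr_ge0 ?sqr_ge0.
    under eq_fun do rewrite centered2 sqrrN.
    rewrite (expectation_finite_index P mJ (fun j => clipc k j ^+ 2)) lee_fin.
    apply: le_trans (momentY k); apply: ler_sum => j _.
    by rewrite ler_wpM2l // clip_sq_le.
  rewrite (_ : (fun t => _) =
      fun t => b (I w t) ^+ 2 * \sum_k A (I w t) k ^+ 2); last first.
    apply/funext => t; rewrite l2norm_sq mulr_sumr; apply: eq_bigr => k _.
    by rewrite centered1 exprMn.
  by rewrite (expectation_finite_index P mI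
    (fun i => b i ^+ 2 * \sum_k A i k ^+ 2)) lee_fin.
Qed.
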